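(* Let $k\geq 3$, $0\leq\epsilon\leq\frac12$ and $0<c<1$. Let \[ r=\frac{1}{\max\{4\epsilon(1-\epsilon),\ \epsilon^2+(1-\epsilon)^2\}}\cdot\frac{c}{\binom{k}{2}}, \] and let $\Phi$ be a random instance of $\epsilon$-1-in-$k$ SAT on $n$ variables drawn from the constant probability model with parameter $p=p(n)$ satisfying $p\binom{n}{k}=rn$. For each $n$ let $(A_n,B_n)\in\{0,1\}^n\times\{0,1\}^n$ be a pair of assignments satisfying \[ 2\cdot\big[\mathrm{overlap}(A_n,B_n)\,(1-\epsilon)\big]^{k-2}\leq 1 . \] Then there exists $\lambda_{c,\epsilon}>0$ such that for all sufficiently large $n$, \[ \Pr\big[(A_n,B_n)\text{ is not }\lambda_{c,\epsilon}\log n\text{-connected}\ \big|\ A_n\models\Phi\text{ and }B_n\models\Phi\big]<\frac1n . \]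
   Context: Let $\epsilon\in[0,1/2]$. An instance of $\epsilon$-1-in-$k$ SAT on variables $x_1,\dots,x_n$ is a conjunction of clauses, each consisting of exactly $k$ literals on $k$ distinct variables; an assignment $A\in\{0,1\}^n$ satisfies it ($A\models\Phi$) if in every clause exactly one literal is true. In the constant probability model with parameter $p$, each of the possible clauses (a set of $k$ distinct variables with a sign for each) that has $i$ negated and $j$ unnegated literals ($i+j=k$) is included independently with probability $p\,\epsilon^{i}(1-\epsilon)^{j}$. The overlap of two assignments $A,B$ is $\mathrm{overlap}(A,B)=|\{i: A(x_i)=B(x_i)\}|/n$. For an integer $l\geq1$, two satisfying assignments $A,B$ of $\Phi$ are $l$-connected if there is a sequence of satisfying assignments $A_0=A,\dots,A_r=B$ of $\Phi$ with consecutive ones at Hamming distance at most $l$. *)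

(* Defs.v *)
From mathcomp Require Import all_boot.
From Stdlib Require Import Reals.

Set Implicit Arguments.
Unset Strict Implicit.
Unset Printing Implicit Defensive.

Section OneInK.
Variable n : nat.

Definition assignment := {ffun 'I_n -> bool}.

(* A (potential) clause: for each variable, None = variable does not occur,
   Some true = occurs negated, Some false = occurs unnegated. *)
Definition clause := {ffun 'I_n -> option bool}.

Definition is_clause (k : nat) (C : clause) : bool :=
  #|[set x | C x != None]| == k.

Definition n_neg (C : clause) : nat := #|[set x | C x == Some true]|.
Definition n_pos (C : clause) : nat := #|[set x | C x == Some false]|.

(* The literal on x (negation flag b) is true under A iff A x = ~~ b, i.e.
   iff C x = Some (~~ A x). Exactly one true literal: *)
Definition sat_clause (A : assignment) (C : clause) : bool :=
  #|[set x | C x == Some (~~ A x)]| == 1%N.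

Definition models (A : assignment) (Phi : {set clause}) : bool :=
  [forall C in Phi, sat_clause A C].

Definition clause_prob (p eps : R) (C : clause) : R :=
  (p * eps ^ n_neg C * (1 - eps) ^ n_pos C)%R.

Definition inst_weight (k : nat) (p eps : R) (Phi : {set clause}) : R :=
  if Phi \subset [set C | is_clause k C] then
    \big[Rmult/1%R]_(C : clause | is_clause k C)
       (if C \in Phi then clause_prob p eps C else (1 - clause_prob p eps C)%R)
  else 0%R.

Definition Pr (k : nat) (p eps : R) (E : pred {set clause}) : R :=
  \big[Rplus/0%R]_(Phi : {set clause} | E Phi) inst_weight k p eps Phi.

Definition hamming (X Y : assignment) : nat := #|[set i | X i != Y i]|.

Definition overlap (X Y : assignment) : R :=
  (INR #|[set i | X i == Y i]| / INR n)%R.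

Definition conn_step (l : R) (Phi : {set clause}) (X Y : assignment) : bool :=
  [&& models X Phi, models Y Phi &
      (if Rle_dec (INR (hamming X Y)) l then true else false)].

Definition l_connected (l : R) (Phi : {set clause}) (A B : assignment) : bool :=
  [&& models A Phi, models B Phi & connect (conn_step l Phi) A B].

End OneInK.

Definition r_param (k : nat) (eps c : R) : R :=
  (/ Rmax (4 * eps * (1 - eps)) (eps ^ 2 + (1 - eps) ^ 2) * (c / INR 'C(k, 2)))%R.

Definition p_param (k : nat) (eps c : R) (n : nat) : R :=
  (r_param k eps c * INR n / INR 'C(n, k))%R.

(* Main.v *)
(* A clause satisfied by both A and B contains either no variable on which A and
   B differ, or exactly two, so the clauses link the differing variables into a
   random graph.  Switching from A to B on a connected component of this graph
   preserves satisfaction, hence A and B are l-connected as soon as all components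
   have size at most l.  Given that A and B are satisfying, the jointly satisfied
   clauses remain independent, and the overlap hypothesis makes the expected degree
   of each vertex at most d = (1 + c) / 2 < 1 for large n.  The component K of a
   vertex then has an exponential moment E[z ^ #|K|] <= F with z > 1, and Markov's
   inequality with a union bound over the vertices concludes. *)
Require Import Defs.
From HB Require Import structures.
From mathcomp Require Import all_boot.
From Stdlib Require Import Reals Lra.

Set Implicit Arguments.
Unset Strict Implicit.
Unset Printing Implicit Defensive.

(** * Finite sums and products of real numbers *)

Fact Rplus_associative : associative Rplus.
Proof. by move=> x y z; rewrite Rplus_assoc. Qed.

HB.instance Definition _ := Monoid.isComLaw.Build R 0%R Rplus
  Rplus_associative Rplus_comm Rplus_0_l.

Fact Rmult_associative : associative Rmult.
Proof. by move=> x y z; rewrite Rmult_assoc. Qed.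

HB.instance Definition _ := Monoid.isComLaw.Build R 1%R Rmult
  Rmult_associative Rmult_comm Rmult_1_l.

HB.instance Definition _ := Monoid.isMulLaw.Build R 0%R Rmult
  Rmult_0_l Rmult_0_r.

Fact Rmult_left_distributive : left_distributive Rmult Rplus.
Proof. by move=> x y z; rewrite Rmult_plus_distr_r. Qed.

Fact Rmult_right_distributive : right_distributive Rmult Rplus.
Proof. by move=> x y z; rewrite Rmult_plus_distr_l. Qed.

HB.instance Definition _ := Monoid.isAddLaw.Build R Rmult Rplus
  Rmult_left_distributive Rmult_right_distributive.

Local Open Scope R_scope.

Section RealBigops.
Variable I : finType.
Implicit Types (P Q : pred I) (F G : I -> R).

Lemma ler_Rsum P F G : (forall i, P i -> F i <= G i) ->
  \big[Rplus/0]_(i | P i) F i <= \big[Rplus/0]_(i | P i) G i.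
Proof.
move=> le; elim/big_ind2: _ => //; first exact: Rle_refl.
by move=> *; apply: Rplus_le_compat.
Qed.

Lemma Rsum_ge0 P F : (forall i, P i -> 0 <= F i) ->
  0 <= \big[Rplus/0]_(i | P i) F i.
Proof.
move=> ge; elim/big_ind: _ => //; first exact: Rle_refl.
by move=> *; apply: Rplus_le_le_0_compat.
Qed.

Lemma Rprod_ge0 P F : (forall i, P i -> 0 <= F i) ->
  0 <= \big[Rmult/1]_(i | P i) F i.
Proof.
move=> ge; elim/big_ind: _ => //; first lra.
by move=> *; apply: Rmult_le_pos.
Qed.

Lemma Rprod_gt0 P F : (forall i, P i -> 0 < F i) ->
  0 < \big[Rmult/1]_(i | P i) F i.
Proof.
move=> gt; elim/big_ind: _ => //; first lra.
by move=> *; apply: Rmult_lt_0_compat.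
Qed.

Lemma ler_Rprod P F G : (forall i, P i -> 0 <= F i <= G i) ->
  \big[Rmult/1]_(i | P i) F i <= \big[Rmult/1]_(i | P i) G i.
Proof.
move=> le.
suff: 0 <= \big[Rmult/1]_(i | P i) F i <= \big[Rmult/1]_(i | P i) G i by case.
elim/big_ind2: _ => //; first lra.
move=> x1 x2 y1 y2 [? ?] [? ?]; split; first exact: Rmult_le_pos.
exact: Rmult_le_compat.
Qed.

Lemma Rsum_const P (a : R) :
  \big[Rplus/0]_(i | P i) a = INR #|P| * a.
Proof.
rewrite big_const; elim: #|P| => [|m IH]; first by rewrite /= Rmult_0_l.
by rewrite iterS IH S_INR; lra.
Qed.

Lemma Rprod_const P (a : R) : \big[Rmult/1]_(i | P i) a = a ^ #|P|.
Proof. by rewrite big_const; elim: #|P| => [//|m IH]; rewrite iterS IH. Qed.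

Lemma Rprod_exp P F :
  \big[Rmult/1]_(i | P i) exp (F i) = exp (\big[Rplus/0]_(i | P i) F i).
Proof. by rewrite (big_morph exp exp_plus exp_0). Qed.

End RealBigops.

(** Grouping the right-hand sum by fibres of [g], every index of the left-hand sum owns a nonempty
    fibre. This bounds a sum over clauses by a sum over parameters without any injectivity of the
    parametrization. *)
Lemma Rsum_le_surj (I J : finType) (P : pred I) (Q : pred J) (g : J -> I)
    (F : I -> R) :
  (forall i, 0 <= F i) ->
  (forall i, P i -> exists2 j, Q j & g j = i) ->
  \big[Rplus/0]_(i | P i) F i <= \big[Rplus/0]_(j | Q j) F (g j).
Proof.
move=> F0 surj; rewrite [X in _ <= X](partition_big g xpredT) //=.
rewrite big_mkcond; apply: ler_Rsum => i _.
case: ifP => [/surj[j Qj gj]|_]; last exact: Rsum_ge0.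
rewrite (bigD1 j) /= ?Qj ?gj ?eqxx // -[X in X <= _]Rplus_0_r.
exact/Rplus_le_compat_l/Rsum_ge0.
Qed.

(** * Random subsets with independent inclusions *)

Section ProductMeasure.
Variables (T : finType) (p : T -> R).
Implicit Types (P Phi : {set T}) (f : {set T} -> R) (C : T).

(** The expectation of [f] at a random subset of [P] that contains each [C] independently with
    probability [p C]. No range is imposed on [p] here, so the algebraic identities hold for
    arbitrary weights. *)
Definition Ex P f : R :=
  \big[Rplus/0]_(Phi : {set T} | Phi \subset P)
    ((\big[Rmult/1]_(C in P) (if C \in Phi then p C else 1 - p C)) * f Phi).

Lemma Rsum_subsetsD1 P C f : C \in P ->
  \big[Rplus/0]_(Phi : {set T} | Phi \subset P) f Phi =
  \big[Rplus/0]_(Phi : {set T} | Phi \subset P :\ C) f Phi +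
  \big[Rplus/0]_(Phi : {set T} | Phi \subset P :\ C) f (C |: Phi).
Proof.
move=> CP; rewrite (bigID (fun Phi : {set T} => C \in Phi)) /= Rplus_comm.
congr (_ + _); first by apply: eq_bigl => Phi; rewrite subsetD1.
rewrite (reindex_onto (fun Phi : {set T} => C |: Phi) (fun Phi => Phi :\ C)) /=;
  last by move=> Phi /andP[_ CPhi]; rewrite setD1K.
apply: eq_bigl => Phi; rewrite setU11 andbT subUset sub1set CP /= subsetD1.
(* If [C] already lies in [Phi], adding and then removing it does not return [Phi], so such [Phi]
   drop out of the reindexed sum. *)
case: (boolP (C \in Phi)) => CPhi; last by rewrite setU1K ?eqxx.
rewrite andbF; apply/negbTE; rewrite negb_and; apply/orP; right.
by apply/eqP => /setP/(_ C); rewrite !inE eqxx CPhi.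
Qed.

(** Conditioning on whether [C] is drawn; this is the step that reveals one clause. *)
Lemma ExD1 P C f : C \in P ->
  Ex P f = (1 - p C) * Ex (P :\ C) f + p C * Ex (P :\ C) (fun Phi => f (C |: Phi)).
Proof.
move=> CP; rewrite /Ex (Rsum_subsetsD1 _ CP) !big_distrr /=.
congr (_ + _); apply: eq_bigr => Phi; rewrite subsetD1 => /andP[_ CPhi];
  rewrite (big_setD1 C) //= ?setU11 ?(negPf CPhi) Rmult_assoc //.
congr (_ * (_ * _)); apply: eq_bigr => X; rewrite !inE => /andP[/negPf-> _].
by [].
Qed.

Lemma Ex0 f : Ex set0 f = f set0.
Proof.
rewrite /Ex (big_pred1 set0); last by move=> Phi; rewrite subset0.
by rewrite big_set0 Rmult_1_l.
Qed.

Lemma Ex_const P (a : R) : Ex P (fun _ => a) = a.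
Proof.
elim: {P}#|P| {-2}P (erefl #|P|) => [|m IH] P cardP.
  by move/eqP: cardP; rewrite cards_eq0 => /eqP->; rewrite Ex0.
have /set0Pn[C CP] : P != set0 by rewrite -card_gt0 cardP.
have cardP' : #|P :\ C| = m by move: cardP; rewrite (cardsD1 C) CP => -[].
by rewrite (ExD1 _ CP) !IH //; ring.
Qed.

Lemma ler_Ex P f g : (forall C, C \in P -> 0 <= p C <= 1) ->
  (forall Phi, Phi \subset P -> f Phi <= g Phi) -> Ex P f <= Ex P g.
Proof.
move=> p01 le; apply: ler_Rsum => Phi sub; apply: Rmult_le_compat_l; last exact: le.
by apply: Rprod_ge0 => C /p01; case: ifP => _; lra.
Qed.

Lemma Ex_sum (I : finType) (Q : pred I) P (f : I -> {set T} -> R) :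
  Ex P (fun Phi => \big[Rplus/0]_(i | Q i) f i Phi) =
  \big[Rplus/0]_(i | Q i) Ex P (f i).
Proof.
by rewrite /Ex exchange_big; apply: eq_bigr => Phi _; rewrite big_distrr.
Qed.

Lemma Ex_scale P f (a : R) : Ex P (fun Phi => a * f Phi) = a * Ex P f.
Proof.
by rewrite /Ex big_distrr; apply: eq_bigr => Phi _ /=; ring.
Qed.

End ProductMeasure.

(** * Connected components as a closure operator *)

Section Closure.
Variables (T V : finType) (inc : T -> {set V}).
Implicit Types (P Phi : {set T}) (W Z : {set V}) (C : T).

(** These [Z] are the unions of connected components of the hypergraph on [V] with edges [inc C],
    for [C] in [Phi]. *)
Definition inc_closed Phi Z :=
  [forall C in Phi, (inc C \subset Z) || [disjoint inc C & Z]].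

(** The union of the components that meet [W]. Taking it as a least closed set avoids reasoning
    about paths. *)
Definition cl Phi W : {set V} :=
  \bigcap_(Z : {set V} | (W \subset Z) && inc_closed Phi Z) Z.

Lemma sub_cl Phi W : W \subset cl Phi W.
Proof. by apply/bigcapsP => Z /andP[]. Qed.

Lemma cl_min Phi W Z : W \subset Z -> inc_closed Phi Z -> cl Phi W \subset Z.
Proof. by move=> WZ cZ; apply: bigcap_inf; rewrite WZ. Qed.

(** For a clause [C], either some closed superset of [W] misses [inc C], and then so does the
    intersection, or all of them contain [inc C], and then so does the intersection. *)
Lemma cl_closed Phi W : inc_closed Phi (cl Phi W).
Proof.
apply/forall_inP => C CPhi.
case: (boolP [exists Z : {set V}, [&& W \subset Z, inc_closed Phi Z &
    [disjoint inc C & Z]]]) => [/existsP[Z /and3P[WZ cZ dis]]|].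
  by apply/orP; right; apply: (disjointWr _ dis); apply: cl_min.
move/existsPn => none; apply/orP; left; apply/bigcapsP => Z /andP[WZ cZ].
have := none Z; rewrite WZ cZ /= => ndis.
by have := forall_inP cZ C CPhi; rewrite (negPf ndis) orbF.
Qed.

Lemma inc_closedU Phi Z1 Z2 :
  inc_closed Phi Z1 -> inc_closed Phi Z2 -> inc_closed Phi (Z1 :|: Z2).
Proof.
move=> /forall_inP c1 /forall_inP c2; apply/forall_inP => C CPhi.
case/orP: (c1 C CPhi) => [s1|d1].
  by apply/orP; left; apply: subset_trans s1 (subsetUl _ _).
case/orP: (c2 C CPhi) => [s2|d2].
  by apply/orP; left; apply: subset_trans s2 (subsetUr _ _).
apply/orP; right; move: d1 d2; rewrite -!setI_eq0 setIUr setU_eq0.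
by move=> -> ->.
Qed.

(** Since [inc C] meets [W], a set containing [W] and closed for [C] must absorb [inc C]; after that
    [C] imposes nothing more. *)
Lemma clU1 Phi W C : ~~ [disjoint inc C & W] ->
  cl (C |: Phi) W = cl Phi (W :|: inc C).
Proof.
move=> meets; apply/eqP; rewrite eqEsubset; apply/andP; split.
  apply: cl_min; first exact: subset_trans (subsetUl _ _) (sub_cl _ _).
  apply/forall_inP => X; rewrite !inE => /predU1P[->|XPhi].
    by rewrite (subset_trans (subsetUr W _) (sub_cl _ _)).
  exact: (forall_inP (cl_closed _ _)).
apply: cl_min; last first.
  apply/forall_inP => X XPhi; apply: (forall_inP (cl_closed _ _)).
  by rewrite inE XPhi orbT.
rewrite subUset sub_cl /=.
have := forall_inP (cl_closed (C |: Phi) W) C (setU11 _ _).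
case/orP=> // dis; case/negP: meets.
exact: disjointWr (sub_cl _ _) dis.
Qed.

Lemma cl_id Phi W : inc_closed Phi W -> cl Phi W = W.
Proof. by move=> cW; apply/eqP; rewrite eqEsubset cl_min //= sub_cl. Qed.

(** * Exponential moment of a component, by exploration *)

Variable p : T -> R.
Variables z F : R.
Hypotheses (z1 : 1 <= z) (F1 : 1 <= F).

(** One generation of a branching process: [z] counts [v] itself, and each clause at [v] contributes
    the mean of a variable equal to [F] if the clause is present and to 1 otherwise. Here [F] stands
    for a bound on the moment of whatever hangs on that clause. *)
Definition branch P v : R :=
  z * \big[Rmult/1]_(C in P | v \in inc C) (1 + p C * (F - 1)).

Lemma branchD1 P v C : C \in P -> v \in inc C ->
  branch P v = branch (P :\ C) v * (1 + p C * (F - 1)).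
Proof.
move=> CP vC; rewrite /branch (bigD1 C) ?CP //= Rmult_assoc; congr (_ * _).
rewrite Rmult_comm; congr (_ * _); apply: eq_bigl => X.
by rewrite !inE; case: (X == C); rewrite /= ?andbF ?andbT.
Qed.

(** Every factor is at least 1 because [F] is, so deleting a clause cannot increase the product. *)
Lemma branchD1_le P v C : (forall C, C \in P -> 0 <= p C <= 1) ->
  0 <= branch (P :\ C) v <= branch P v.
Proof.
move=> p01.
have ge1 X : X \in P -> 1 <= 1 + p X * (F - 1).
  by move/p01 => [? ?]; have := Rmult_le_pos (p X) (F - 1); lra.
have pos : 0 <= branch (P :\ C) v.
  apply: Rmult_le_pos; first lra.
  by apply: Rprod_ge0 => X; rewrite !inE => /andP[/andP[_ /ge1]]; lra.
split=> //; case: (boolP (C \in P)) => CP; last first.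
  have -> : P :\ C = P by apply/setDidPl; rewrite disjoint_sym disjoints1.
  exact: Rle_refl.
case: (boolP (v \in inc C)) => vC; last first.
  apply: Req_le; rewrite /branch; congr (_ * _); apply: eq_bigl => X; rewrite !inE.
  by case: (eqVneq X C) => //= ->; rewrite (negPf vC) andbF.
rewrite (branchD1 CP vC) -[X in X <= _]Rmult_1_r.
by apply: Rmult_le_compat_l => //; apply: ge1.
Qed.

(** The exploration has stopped: no clause crosses the boundary of [W], so the closure is [W]
    itself, and each [branch] factor is at least [z]. *)
Lemma Ex_cl_closed_le P W : (forall C, C \in P -> 0 <= p C <= 1) ->
  inc_closed P W ->
  Ex p P (fun Phi => z ^ #|cl Phi W|) <= \big[Rmult/1]_(w in W) branch P w.
Proof.
move=> p01 cW; apply: (Rle_trans _ (z ^ #|W|)).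
  rewrite -[X in _ <= X](Ex_const p P); apply: ler_Ex => // Phi sub.
  rewrite cl_id; first exact: Rle_refl.
  by apply/forall_inP => C CPhi; apply: (forall_inP cW); apply: (subsetP sub).
rewrite -Rprod_const; apply: ler_Rprod => w _; split; first lra.
rewrite -[X in X <= _]Rmult_1_r; apply: Rmult_le_compat_l; first lra.
elim/big_rec: _ => [|C x /andP[CP _] x1]; first exact: Rle_refl.
have [pC0 pC1] := p01 _ CP.
have ge0 : 0 <= p C * (F - 1) by apply: Rmult_le_pos; lra.
by have := Rmult_le_compat 1 (1 + p C * (F - 1)) 1 x; lra.
Qed.

(* The clauses crossing the boundary of the explored set [W] are revealed one at a
   time.  A revealed clause is either absent, or adds to [W] one new vertex, whose
   factor is at most [F]; in expectation this costs the factor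
   [1 + p C * (F - 1)], which the hit vertex of [W] gives up with the clause. *)
Lemma Ex_cl_le P W :
  (forall C, C \in P -> (#|inc C| <= 2)%nat) ->
  (forall C, C \in P -> 0 <= p C <= 1) ->
  (forall v, branch P v <= F) ->
  Ex p P (fun Phi => z ^ #|cl Phi W|) <= \big[Rmult/1]_(w in W) branch P w.
Proof.
move En : #|P| => m; elim: m => [|m IH] in P W En *; move=> inc2 p01 brF;
  case: (boolP (inc_closed P W)) => [|]; try exact: Ex_cl_closed_le.
  by case/forall_inPn => C CP; rewrite (card0_eq En) in CP.
move/forall_inPn => [C CP]; rewrite negb_or => /andP[nsub meets].
have card' : #|P :\ C| = m by move: En; rewrite (cardsD1 C) CP => -[].
have p01' X : X \in P :\ C -> 0 <= p X <= 1 by rewrite inE => /andP[_ /p01].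
have inc2' X : X \in P :\ C -> (#|inc X| <= 2)%nat.
  by rewrite inE => /andP[_ /inc2].
have brF' v : branch (P :\ C) v <= F.
  by have := @branchD1_le P v C p01; have := brF v; lra.
have [v vC vW] : exists2 v, v \in inc C & v \in W.
  by move/pred0Pn: meets => [v /andP[]]; exists v.
have [y yC yW] : exists2 y, y \in inc C & y \notin W by apply/subsetPn.
have UW : W :|: inc C = y |: W.
  have vy : v != y by apply: contraNneq yW => <-.
  have -> : inc C = [set v; y].
    apply/eqP; rewrite eq_sym eqEcard cards2 vy inc2 // andbT.
    by rewrite subUset !sub1set vC yC.
  by rewrite setUA (setUidPl (_ : [set v] \subset W)) ?sub1set // setUC.
set g := \big[Rmult/1]_(w in W) branch (P :\ C) w.
have g0 : 0 <= g by apply: Rprod_ge0 => w _; case: (@branchD1_le P w C p01).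
have Ex1 : Ex p (P :\ C) (fun Phi => z ^ #|cl Phi W|) <= g by apply: IH.
have Ex2 : Ex p (P :\ C) (fun Phi => z ^ #|cl (C |: Phi) W|) <= F * g.
  apply: (Rle_trans _ (Ex p (P :\ C) (fun Phi => z ^ #|cl Phi (y |: W)|))).
    by apply: ler_Ex => // Phi _; rewrite clU1 // UW; apply: Rle_refl.
  apply: (Rle_trans _ _ _ (IH _ (y |: W) card' inc2' p01' brF')).
  by rewrite big_setU1 //=; apply: Rmult_le_compat_r.
have [pC0 pC1] := p01 C CP.
(* Averaging over [C] gives [(1 - p C) * g + p C * (F * g)], which is this quantity. *)
apply: (Rle_trans _ (g * (1 + p C * (F - 1)))).
  rewrite (ExD1 _ _ CP).
  have := Rmult_le_compat_l (1 - p C) _ _ _ Ex1.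
  have := Rmult_le_compat_l (p C) _ _ pC0 Ex2; lra.
(* The factor for [C] is charged to [v] alone; the other vertices only need monotonicity in the
   clause set. *)
rewrite /g (bigD1 v vW) [X in _ <= X](bigD1 v vW) /= (branchD1 CP vC).
have := @branchD1_le P v C p01 => -[b0 _].
have ge0 : 0 <= p C * (F - 1) by apply: Rmult_le_pos; lra.
rewrite Rmult_assoc [X in _ * X]Rmult_comm -Rmult_assoc.
apply: Rmult_le_compat_l; first by apply: Rmult_le_pos; lra.
by apply: ler_Rprod => w _; apply: branchD1_le.
Qed.

Lemma branch_le P v (d : R) : (forall C, C \in P -> 0 <= p C) ->
  \big[Rplus/0]_(C in P | v \in inc C) p C <= d ->
  branch P v <= z * exp (d * (F - 1)).
Proof.
move=> p0 deg; apply: Rmult_le_compat_l; first lra.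
apply: (Rle_trans _ (exp ((\big[Rplus/0]_(C in P | v \in inc C) p C) * (F - 1)))).
  rewrite big_distrl /= -Rprod_exp; apply: ler_Rprod => C /andP[/p0 pC _].
  split; last exact: exp_ineq1_le.
  have := Rmult_le_pos (p C) (F - 1); lra.
have : (\big[Rplus/0]_(C in P | v \in inc C) p C) * (F - 1) <= d * (F - 1).
  by apply: Rmult_le_compat_r; lra.
by case=> [lt|->]; [left; apply: exp_increasing|right].
Qed.

End Closure.

(** * Jointly satisfied clauses and switching between the assignments *)

Section JointlySatisfied.
Variables (n k : nat) (A B : assignment n).
Implicit Types (C : clause n) (Phi : {set clause n}) (Z T : {set 'I_n}).

Definition diff_vars : {set 'I_n} := [set x | A x != B x].
Definition same_vars : {set 'I_n} := [set x | A x == B x].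

Definition diff_support C : {set 'I_n} :=
  [set x | (A x != B x) && (C x != None)].

Definition joint_clauses : {set clause n} :=
  [set C | [&& is_clause k C, sat_clause A C & sat_clause B C]].

Definition mix Z : assignment n := [ffun x => if x \in Z then B x else A x].

Lemma eq_sat_clause (X Y : assignment n) C :
  (forall x, C x != None -> X x = Y x) -> sat_clause X C = sat_clause Y C.
Proof.
move=> eqXY; rewrite /sat_clause; congr (_ == _); apply: eq_card => x.
rewrite !inE; case Cx: (C x) (eqXY x) => [b|//] /(_ isT) ->.
by [].
Qed.

(** Closedness makes each clause see a single assignment: [B] if its differing variables lie in [Z],
    and [A] if none does. *)
Lemma models_mix Phi Z : models A Phi -> models B Phi ->
  inc_closed diff_support Phi Z -> models (mix Z) Phi.
Proof.
move=> /forall_inP mA /forall_inP mB /forall_inP cZ; apply/forall_inP => C CPhi.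
case/orP: (cZ C CPhi) => [sub|dis].
  rewrite (@eq_sat_clause _ B) ?mB // => x Cx; rewrite ffunE.
  case: ifP => // /negP xZ; apply/eqP; apply: contraT => xD; case: xZ.
  by apply: (subsetP sub); rewrite inE xD.
rewrite (@eq_sat_clause _ A) ?mA // => x Cx; rewrite ffunE.
case: ifP => // xZ; apply/eqP; rewrite eq_sym; apply: contraT => xD.
by have := disjointFl dis xZ; rewrite inE xD Cx.
Qed.

(** Components are switched one after another, by induction on the number of differing variables not
    yet switched. *)
Lemma connect_mix Phi Z (l : R) : models A Phi -> models B Phi ->
  (forall v, v \in diff_vars -> INR #|cl diff_support Phi [set v]| <= l) ->
  inc_closed diff_support Phi Z -> connect (conn_step l Phi) (mix Z) B.
Proof.
move=> mA mB small.
elim: {Z}_.+1 {-2}Z (ltnSn #|diff_vars :\: Z|) => // m IH Z ltm cZ.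
case: (boolP (diff_vars \subset Z)) => [sub|/subsetPn[v vD vZ]].
  rewrite (_ : mix Z = B) ?connect0 //; apply/ffunP => x; rewrite ffunE.
  case: ifP => // /negP xZ; apply/eqP; apply: contraT => xD; case: xZ.
  by apply: (subsetP sub); rewrite inE.
set K := cl diff_support Phi [set v].
have vK : v \in K by rewrite -sub1set sub_cl.
have cZK : inc_closed diff_support Phi (Z :|: K).
  by apply: inc_closedU cZ _; apply: cl_closed.
apply: (connect_trans _ (IH (Z :|: K) _ cZK)); last first.
  rewrite -ltnS; apply: leq_trans ltm; rewrite ltnS; apply: proper_card; apply/properP; split.
    by apply: setDS; apply: subsetUl.
  by exists v; rewrite in_setD ?vD ?vZ // in_setU vK orbT.
apply: connect1; rewrite /conn_step !models_mix //=.
(* The two mixtures differ only inside [K], so their Hamming distance is at most the size of [K]. *)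
case: Rle_dec => // nle; case: nle; apply: (Rle_trans _ _ _ _ (small v vD)).
apply/le_INR/leP/subset_leq_card/subsetP => x; rewrite !inE !ffunE inE.
by case: (x \in K) => //; rewrite orbF eqxx.
Qed.

Lemma l_connected_small Phi (l : R) : models A Phi -> models B Phi ->
  (forall v, v \in diff_vars -> INR #|cl diff_support Phi [set v]| <= l) ->
  l_connected l Phi A B.
Proof.
move=> mA mB small; rewrite /l_connected mA mB /=.
have {1}-> : A = mix set0 by apply/ffunP => x; rewrite ffunE inE.
apply: connect_mix => //; apply/forall_inP => C _.
by rewrite -setI_eq0 setI0 eqxx orbT.
Qed.

Lemma sat_clauseP (X : assignment n) C : sat_clause X C ->
  exists a, forall x, (C x == Some (~~ X x)) = (x == a).
Proof.
by case/cards1P => a /setP eqa; exists a => x; have := eqa x; rewrite !inE.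
Qed.

(** A literal on a differing variable is true under exactly one of [A] and [B], so its variable
    carries the unique true literal of one of them. *)
Lemma diff_support_le2 C : sat_clause A C -> sat_clause B C ->
  (#|diff_support C| <= 2)%nat.
Proof.
move=> /sat_clauseP[a Ca] /sat_clauseP[b Cb].
apply: (@leq_trans #|[set a; b]|); last by rewrite cards2; case: eqP.
apply/subset_leq_card/subsetP => x; rewrite !inE -Ca -Cb.
by case: (A x) (B x) (C x) => [] [] [[]|].
Qed.

(* The flag [b] records whether the literal on [v] is the one true under [A]. *)
Definition pair_clause (v : 'I_n) (i : ('I_n * bool) * {set 'I_n}) : clause n :=
  [ffun x => if x == v then Some (i.1.2 (+) A v)
             else if x == i.1.1 then Some (~~ i.1.2 (+) A i.1.1)
             else if x \in i.2 then Some (A x) else None].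

(** Let [a] and [b] carry the literals true under [A] and under [B]. They are distinct, since [v] is
    exactly one of them, and [A] and [B] differ on both. The other [k - 2] literals lie on agreeing
    variables and are false, which forces their signs. *)
Lemma joint_clause_pair C v : C \in joint_clauses -> v \in diff_support C ->
  exists2 i : ('I_n * bool) * {set 'I_n},
    [&& i.1.1 \in diff_vars :\ v, i.2 \subset same_vars & #|i.2| == (k - 2)%nat]
    & pair_clause v i = C.
Proof.
rewrite !inE => /and3P[/eqP kC /sat_clauseP[a Ca] /sat_clauseP[b Cb]].
move=> /andP[vD Cv].
have dich x : A x != B x -> C x != None -> (x == a) (+) (x == b).
  by rewrite -Ca -Cb; case: (A x) (B x) (C x) => [] [] [[]|].
have same x : C x != None -> A x == B x -> (x == a) = (x == b).
  by rewrite -Ca -Cb => _ /eqP ->.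
have Ca0 : C a = Some (~~ A a) by apply/eqP; rewrite Ca.
have Cb0 : C b = Some (~~ B b) by apply/eqP; rewrite Cb.
have ab : a != b by have := dich v vD Cv; apply: contraTneq => ->; rewrite addbb.
have aD : A a != B a.
  by apply: contraNN ab => /(same a); rewrite Ca0 eqxx => <-.
have bD : A b != B b.
  by apply: contraNN ab => /(same b); rewrite Cb0 eqxx [a == b]eq_sym => ->.
(* The partner of [v] among [a] and [b]. *)
pose y := if v == a then b else a.
have vy : y != v.
  rewrite /y; have := dich v vD Cv; case: (eqVneq v a) => [->|].
    by rewrite eq_sym.
  by rewrite eq_sym.
have yD : A y != B y by rewrite /y; case: ifP.
have inab x : A x != B x -> C x != None -> (x == v) || (x == y).
  move=> xD Cx; have := dich v vD Cv; have := dich x xD Cx; rewrite /y.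
  case: (eqVneq v a) => [->|va] /=; first by case: (x == a).
  by move=> + /eqP->; case: (x == a); case: (x == b).
have Cy : C y != None by rewrite /y; case: ifP => _; rewrite ?Ca0 ?Cb0.
exists ((y, v == a), [set x | C x != None] :\ v :\ y) => /=.
  rewrite !inE vy yD /=; apply/andP; split.
    apply/subsetP => x; rewrite !inE => /and3P[xy xv Cx].
    by apply: contraT => /inab/(_ Cx); rewrite (negPf xy) (negPf xv).
  apply/eqP; move: kC.
  by rewrite (cardsD1 v) (cardsD1 y) !inE Cv vy Cy /= => <-; rewrite subn2.
apply/ffunP => x; rewrite ffunE /=.
have val x' : C x' != None -> C x' = Some ((x' == a) (+) A x').
  move=> Cx; rewrite -Ca; move: Cx; by case: (A x') (C x') => [] [[]|].
case: (eqVneq x v) => [->|xv]; first by rewrite [RHS]val.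
have ya : (y == a) = (v != a).
  by rewrite /y; case: (eqVneq v a) => [_|_]; rewrite ?eqxx // eq_sym (negPf ab).
case: (eqVneq x y) => [->|xy]; first by rewrite [RHS]val // ya.
rewrite !inE xv xy /=; case: (boolP (C x == None)) => [/eqP->//|Cx] /=.
rewrite [RHS]val //; suff -> : (x == a) = false by [].
case: (eqVneq x a) => // xa; have := inab x.
by rewrite (negPf xv) (negPf xy) xa Ca0 aD => /(_ isT isT).
Qed.

End JointlySatisfied.

(** * Expected degree of a differing variable *)

Section DegreeBound.
Variables (n k : nat) (A B : assignment n) (p eps : R).
Hypotheses (p0 : 0 <= p) (eps01 : 0 <= eps <= 1 / 2).

Definition lit_weight (o : option bool) : R :=
  if o is Some b then if b then eps else 1 - eps else 1.

Lemma lit_weight_ge0 o : 0 <= lit_weight o.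
Proof. by case: o => [[]|] /=; lra. Qed.

Lemma clause_probE (C : clause n) :
  clause_prob p eps C = p * \big[Rmult/1]_x lit_weight (C x).
Proof.
rewrite /clause_prob Rmult_assoc; congr (_ * _).
rewrite /n_neg /n_pos !cardsE -!Rprod_const.
rewrite big_mkcond [X in _ * X]big_mkcond -big_split; apply: eq_bigr => x _ /=.
by rewrite /in_mem /=; case: (C x) => [[]|] /=; lra.
Qed.

Lemma clause_prob_ge0 (C : clause n) : 0 <= clause_prob p eps C.
Proof.
rewrite clause_probE; apply: Rmult_le_pos => //.
by apply: Rprod_ge0 => x _; apply: lit_weight_ge0.
Qed.

Lemma clause_prob_le (C : clause n) : clause_prob p eps C <= p.
Proof.
rewrite clause_probE -[X in _ <= X]Rmult_1_r; apply: Rmult_le_compat_l => //.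
apply: (Rle_trans _ (\big[Rmult/1]_(x : 'I_n) 1)); last first.
  by rewrite big1 //; apply: Rle_refl.
apply: ler_Rprod => x _; split; first exact: lit_weight_ge0.
by case: (C x) => [[]|] /=; lra.
Qed.

(** As [eps] is at most 1/2, each literal on [T] weighs at most [1 - eps] whatever its sign; the
    absent variables weigh 1. *)
Lemma pair_clause_weight v y b (T : {set 'I_n}) :
  y != v -> v \notin T -> y \notin T ->
  \big[Rmult/1]_x lit_weight (pair_clause A v (y, b, T) x) <=
  lit_weight (Some (b (+) A v)) * lit_weight (Some (~~ b (+) A y)) *
    (1 - eps) ^ #|T|.
Proof.
move=> yv vT yT.
rewrite (bigD1 v) //= (bigD1 y) //= !ffunE /= !eqxx (negPf yv).
rewrite -Rmult_assoc; apply: Rmult_le_compat_l.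
  by apply: Rmult_le_pos; apply: lit_weight_ge0.
have -> : (1 - eps) ^ #|T| = \big[Rmult/1]_(x in T) (1 - eps).
  by rewrite Rprod_const.
rewrite [X in _ <= X](bigID (fun x => (x != v) && (x != y))) /=.
rewrite [X in _ <= _ * X]big_pred0 ?Rmult_1_r; last first.
  move=> x; rewrite -negb_or; case: (eqVneq x v) => [->|_]; first by rewrite (negPf vT).
  by case: (eqVneq x y) => [->|_]; rewrite ?(negPf yT) ?andbF.
rewrite [X in _ <= X]big_mkcondl; apply: ler_Rprod => x /andP[xv xy].
split; first exact: lit_weight_ge0.
rewrite ffunE /= (negPf xv) (negPf xy); case: ifP => _ /=; last exact: Rle_refl.
by case: (A x); lra.
Qed.

(** The sum is [2 * eps * (1 - eps)] when [a = b] and equals the bound otherwise; the difference of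
    the two values is the square of [1 - 2 * eps]. *)
Lemma sum_pair_weight (a b : bool) :
  \big[Rplus/0]_(f : bool)
    (lit_weight (Some (f (+) a)) * lit_weight (Some (~~ f (+) b))) <=
  eps ^ 2 + (1 - eps) ^ 2.
Proof. by rewrite big_bool; case: a b => [] [] /=; nra. Qed.

Lemma degree_le v : v \in diff_vars A B ->
  \big[Rplus/0]_(C in joint_clauses k A B | v \in diff_support A B C)
    clause_prob p eps C <=
  p * INR n * (eps ^ 2 + (1 - eps) ^ 2) *
    (INR 'C(#|same_vars A B|, k - 2) * (1 - eps) ^ (k - 2)).
Proof.
move=> vD.
have vS : v \notin same_vars A B by move: vD; rewrite !inE.
pose Q (i : ('I_n * bool) * {set 'I_n}) :=
  [&& i.1.1 \in diff_vars A B :\ v, i.2 \subset same_vars A B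
    & #|i.2| == (k - 2)%nat].
apply: (Rle_trans _ (\big[Rplus/0]_(i | Q i) clause_prob p eps (pair_clause A v i))).
  apply: Rsum_le_surj => [C|C /andP[]]; first exact: clause_prob_ge0.
  exact: joint_clause_pair.
pose G (y : 'I_n) (b : bool) :=
  p * (lit_weight (Some (b (+) A v)) * lit_weight (Some (~~ b (+) A y))) *
    (1 - eps) ^ (k - 2).
apply: (Rle_trans _ (\big[Rplus/0]_(i | Q i) G i.1.1 i.1.2)).
  apply: ler_Rsum => -[[y b] T] /and3P[/= yD TS /eqP cT].
  rewrite clause_probE /G Rmult_assoc; apply: Rmult_le_compat_l => //.
  rewrite -cT; move: yD; rewrite !inE => /andP[yv yD].
  apply: pair_clause_weight => //; apply/negP => /(subsetP TS); last by rewrite inE (negPf yD).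
  exact/negP.
(* The summand no longer depends on the set [T], so the inner sum only counts the choices of [T]. *)
rewrite -(pair_big_dep (fun i : 'I_n * bool => i.1 \in diff_vars A B :\ v)
  (fun (i : 'I_n * bool) (T : {set 'I_n}) => (T \subset same_vars A B) && (#|T| == (k - 2)%nat))
  (fun i T => G i.1 i.2)) /=.
under eq_bigr => i _.
  rewrite Rsum_const.
  have -> : #|[pred T : {set 'I_n} | (T \subset same_vars A B) && (#|T| == (k - 2)%nat)]|
    = 'C(#|same_vars A B|, k - 2).
    by rewrite -cards_draws cardsE.
  over.
rewrite -big_distrr /=.
set S := \big[Rplus/0]_(_ | _) _.
have SE : S = \big[Rplus/0]_(y in diff_vars A B :\ v) \big[Rplus/0]_(b : bool) G y b.
  by rewrite pair_big_dep; apply: eq_bigl => i; rewrite andbT.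
suff le : S <= INR n * (p * (eps ^ 2 + (1 - eps) ^ 2) * (1 - eps) ^ (k - 2)).
  apply: (Rle_trans _ _ _ (Rmult_le_compat_l _ _ _ (pos_INR _) le)).
  by apply: Req_le; ring.
rewrite SE; set q := (X in _ * X).
have pw : 0 <= (1 - eps) ^ (k - 2) by apply: pow_le; lra.
have q0 : 0 <= q by apply: Rmult_le_pos => //; apply: Rmult_le_pos => //; nra.
apply: (Rle_trans _ (\big[Rplus/0]_(y in diff_vars A B :\ v) q)).
  apply: ler_Rsum => y _; rewrite /G -big_distrl -big_distrr /=.
  apply: Rmult_le_compat_r => //; apply: Rmult_le_compat_l => //.
  exact: sum_pair_weight.
rewrite Rsum_const; apply: Rmult_le_compat_r => //.
apply/le_INR/leP; rewrite -[X in (_ <= X)%nat]card_ord; exact: max_card.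
Qed.

End DegreeBound.

(** * Conditioning on both assignments being satisfying *)

Section InstanceMeasure.
Variables (n k : nat) (A B : assignment n) (p eps : R).

(** The probability that no clause violated by [A] or by [B] is drawn, that is, the probability of
    the conditioning event. *)
Definition unsat_factor : R :=
  \big[Rmult/1]_(C | is_clause k C && (C \notin joint_clauses k A B))
    (1 - clause_prob p eps C).

(** Both assignments satisfy [Phi] exactly when all its clauses are jointly satisfied. By
    independence the absence of the other clauses factors out, and the jointly satisfied ones keep
    their product law. *)
Lemma Pr_joint (Q : pred {set clause n}) :
  Pr k p eps (fun Phi => [&& models A Phi, models B Phi & Q Phi]) =
  unsat_factor * Ex (clause_prob p eps) (joint_clauses k A B)
    (fun Phi => if Q Phi then 1 else 0).
Proof.
rewrite /Pr /Ex big_distrr big_mkcond [RHS]big_mkcond /=.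
apply: eq_bigr => Phi _; rewrite /inst_weight.
case: (boolP (Phi \subset joint_clauses k A B)) => [sub|nsub].
  have mA : models A Phi.
    by apply/forall_inP => C /(subsetP sub); rewrite inE => /and3P[].
  have mB : models B Phi.
    by apply/forall_inP => C /(subsetP sub); rewrite inE => /and3P[].
  rewrite mA mB /=; case: (Q Phi); last by rewrite !Rmult_0_r.
  have -> : Phi \subset [set C | is_clause k C].
    by apply/subsetP => C /(subsetP sub); rewrite !inE => /and3P[].
  rewrite (bigID (mem (joint_clauses k A B))) /= Rmult_comm Rmult_1_r.
  congr (_ * _).
    apply: eq_bigr => C /andP[_ CJ]; case: ifP => // /(subsetP sub) CJ'.
    by rewrite CJ' in CJ.
  apply: eq_bigl => C; rewrite !inE; case: (is_clause k C) => //=.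
case: ifP => // /and3P[mA mB _]; case: ifP => // sub; case/negP: nsub.
apply/subsetP => C CPhi; have := subsetP sub C CPhi; rewrite !inE => -> /=.
by rewrite (forall_inP mA) // (forall_inP mB).
Qed.

End InstanceMeasure.

(** * Binomial estimates and the clause probability *)

Section Estimates.

Lemma INR_muln a b : INR (a * b)%nat = INR a * INR b.
Proof. exact: mult_INR. Qed.

Lemma INR_subn a b : (b <= a)%nat -> INR (a - b)%nat = INR a - INR b.
Proof. by move/leP; apply: minus_INR. Qed.

Lemma INR_ffact_le s m : INR (s ^_ m) <= INR s ^ m.
Proof.
elim: m => [|m IH]; first by rewrite ffactn0; apply: Rle_refl.
rewrite ffactnSr INR_muln [X in _ <= X]/= [X in _ <= X]Rmult_comm.
apply: Rmult_le_compat => //; try exact: pos_INR.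
exact/le_INR/leP/leq_subr.
Qed.

Lemma INR_ffact_ge n k m : (m <= k <= n)%nat ->
  (INR n - INR k) ^ m <= INR (n ^_ m).
Proof.
case/andP=> + kn; elim: m => [|m IH] mk; first by rewrite ffactn0; apply: Rle_refl.
have kn' : 0 <= INR n - INR k by rewrite -INR_subn //; apply: pos_INR.
rewrite ffactnSr INR_muln /= Rmult_comm; apply: Rmult_le_compat => //.
- exact: pow_le.
- by apply: IH; apply: ltnW.
rewrite INR_subn; last exact: leq_trans (ltnW mk) kn.
by have /leP/le_INR := ltnW mk; lra.
Qed.

Lemma Bernoulli_sub x m : 0 <= x <= 1 -> 1 - INR m * x <= (1 - x) ^ m.
Proof.
move=> x01; elim: m => [|m IH]; first by rewrite /=; lra.
have := Rmult_le_compat_l (1 - x) _ _ _ IH.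
have := Rmult_le_pos _ _ (pos_INR m) (Rle_0_sqr x).
by rewrite S_INR /Rsqr /=; nra.
Qed.

Lemma INR_bin_le s j : INR 'C(s, j) * INR j`! <= INR s ^ j.
Proof. by rewrite -INR_muln bin_ffact; apply: INR_ffact_le. Qed.

Lemma INR_bin_ge n k : (k <= n)%nat ->
  (INR n - INR k) ^ k <= INR 'C(n, k) * INR k`!.
Proof.
by move=> kn; rewrite -INR_muln bin_ffact; apply: INR_ffact_ge; rewrite leqnn.
Qed.

(** Used with [j = k - 2]: the binomial cancels the one in the clause density, and the 2 matches the
    2 of the overlap hypothesis. *)
Lemma INR_fact_bin2 j : INR j.+2`! = 2 * INR 'C(j.+2, 2) * INR j`!.
Proof.
have -> : j.+2`! = ('C(j.+2, 2) * 2`! * j`!)%nat.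
  by rewrite bin_ffact ffactnS ffactn1 !factS mulnA.
by rewrite !INR_muln (_ : INR 2 = 2) // INR_1; ring.
Qed.

Variables (k n : nat) (eps c : R).
Hypotheses (k3 : (3 <= k)%nat) (eps01 : 0 <= eps <= 1 / 2) (c01 : 0 < c < 1).
Hypotheses (nk : 2 * INR k + 2 < INR n) (nfact : 8 * INR k`! < INR n).

Let leq_k_n : (k <= n)%nat.
Proof. by apply/leP/INR_le; have := pos_INR k; lra. Qed.

Let bin2_ge1 : 1 <= INR 'C(k, 2).
Proof.
by apply: (le_INR 1); apply/leP; rewrite bin_gt0; apply: leq_trans k3.
Qed.

Let bin_gt0' : 0 < INR 'C(n, k).
Proof. by apply: (lt_INR 0); apply/ltP; rewrite bin_gt0. Qed.

Let denom : R := Rmax (4 * eps * (1 - eps)) (eps ^ 2 + (1 - eps) ^ 2).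

Let denom_ge : eps ^ 2 + (1 - eps) ^ 2 <= denom.
Proof. exact: Rmax_r. Qed.

Let denom_ge_half : 1 / 2 <= denom.
Proof.
apply: (Rle_trans _ _ _ _ denom_ge).
by have := Rle_0_sqr (1 - 2 * eps); rewrite /Rsqr /=; lra.
Qed.

Let p : R := p_param k eps c n.

Let p_def : p * (denom * INR 'C(k, 2) * INR 'C(n, k)) = c * INR n.
Proof.
rewrite /p /p_param /r_param -/denom; field; split; last split; lra.
Qed.

Lemma p_param_gt0 : 0 < p.
Proof.
have [] : 0 < c * INR n /\ 0 < denom * INR 'C(k, 2) * INR 'C(n, k).
  split; first by apply: Rmult_lt_0_compat; have := pos_INR k; lra.
  by apply: Rmult_lt_0_compat => //; apply: Rmult_lt_0_compat; lra.
rewrite -p_def => pd d; apply: (Rmult_lt_reg_r _ _ _ d); lra.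
Qed.

(** Since [n - k] exceeds [n / 2] and [n] exceeds [8 * k!], the binomial ['C(n, k)] exceeds [2 * n];
    the maximum in the density is at least 1/2. *)
Lemma p_param_lt1 : p < 1.
Proof.
have d : 0 < denom * INR 'C(k, 2) * INR 'C(n, k).
  by apply: Rmult_lt_0_compat => //; apply: Rmult_lt_0_compat; lra.
apply: (Rmult_lt_reg_r _ _ _ d); rewrite p_def Rmult_1_l.
have f1 : 1 <= INR k`! by apply: (le_INR 1); apply/leP; apply: fact_gt0.
have kpos := pos_INR k.
have quad : INR n * INR n / 4 < INR 'C(n, k) * INR k`!.
  apply: Rlt_le_trans (INR_bin_ge leq_k_n).
  apply: (Rlt_le_trans _ ((INR n - INR k) ^ 2)); first by rewrite /=; nra.
  by apply: Rle_pow; [lra | apply/leP/ltnW].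
have half : / 2 * INR 'C(n, k) <= denom * INR 'C(k, 2) * INR 'C(n, k).
  by apply: Rmult_le_compat_r; nra.
suff : 2 * INR n < INR 'C(n, k) by nra.
apply: (Rmult_lt_reg_r (INR k`!)); first lra.
apply: Rlt_trans quad; nra.
Qed.

(** The overlap hypothesis bounds the choices on agreeing variables by half of
    [n ^ (k - 2) / (k - 2)!], and the maximum in the density absorbs [eps ^ 2 + (1 - eps) ^ 2]. What
    remains is [c] times the ratio of [n ^ k] to [(n - k) ^ k]. *)
Lemma degree_estimate s d : c * INR n ^ k <= d * (INR n - INR k) ^ k ->
  0 <= d -> 2 * (INR s / INR n * (1 - eps)) ^ (k - 2) <= 1 ->
  p * INR n * (eps ^ 2 + (1 - eps) ^ 2) *
    (INR 'C(s, k - 2) * (1 - eps) ^ (k - 2)) <= d.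
Proof.
move=> cd d0 ov.
have n0 : 0 < INR n by have := pos_INR k; lra.
set j := (k - 2)%nat in ov *.
have kj : k = j.+2 by rewrite /j -addn2 subnK // ltnW.
set Y := INR 'C(s, j) * (1 - eps) ^ j.
have e0 : 0 <= (1 - eps) ^ j by apply: pow_le; lra.
have Y0 : 0 <= Y by apply: Rmult_le_pos => //; apply: pos_INR.
have f0 : 0 < INR j`! by apply: (lt_INR 0); apply/ltP; apply: fact_gt0.
have Yle : 2 * INR n ^ 2 * Y * INR j`! <= INR n ^ k.
  have -> : INR n ^ k = INR n ^ 2 * INR n ^ j by rewrite kj /=; ring.
  have : Y * INR j`! <= (INR s * (1 - eps)) ^ j.
    rewrite /Y Rpow_mult_distr.
    by have := Rmult_le_compat_r _ _ _ e0 (INR_bin_le s j); lra.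
  have : 2 * (INR s * (1 - eps)) ^ j <= INR n ^ j.
    have -> : (INR s * (1 - eps)) ^ j = (INR s / INR n * (1 - eps)) ^ j * INR n ^ j.
      by rewrite -Rpow_mult_distr; congr (_ ^ _); field; lra.
    by have := Rmult_le_compat_r _ _ _ (pow_le _ j (Rlt_le _ _ n0)) ov; lra.
  move=> l1 l2; have l3 : 2 * Y * INR j`! <= INR n ^ j by lra.
  by have := Rmult_le_compat_l _ _ _ (pow_le _ 2 (Rlt_le _ _ n0)) l3; lra.
set X := INR 'C(k, 2) * INR 'C(n, k).
have X0 : 0 < X by apply: Rmult_lt_0_compat; lra.
have Xge : (INR n - INR k) ^ k <= 2 * X * INR j`!.
  apply: Rle_trans (INR_bin_ge leq_k_n) _.
  have -> : INR k`! = 2 * INR 'C(k, 2) * INR j`! by rewrite kj INR_fact_bin2.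
  by apply: Req_le; rewrite /X; ring.
have cY : c * INR n ^ 2 * Y <= d * X.
  apply: (Rmult_le_reg_r (2 * INR j`!)); first lra.
  have := Rmult_le_compat_l _ _ _ d0 Xge.
  have := Rmult_le_compat_l _ _ _ (Rlt_le _ _ (proj1 c01)) Yle; lra.
apply: (Rmult_le_reg_r X) => //; apply: Rle_trans cY.
have pn : 0 <= p * INR n * Y * X.
  have := p_param_gt0 => p0.
  by repeat (apply: Rmult_le_pos; try lra).
have := Rmult_le_compat_l _ _ _ pn denom_ge.
suff -> : c * INR n ^ 2 * Y = p * INR n * Y * X * denom by lra.
have -> : c * INR n ^ 2 * Y = (c * INR n) * (INR n * Y) by ring.
by rewrite -p_def /X; ring.
Qed.

End Estimates.

(** * Choice of constants and the union bound *)

Lemma ler_Rpow_scaled (c d : R) (k n : nat) :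
  0 <= d -> 0 < INR n -> (k <= n)%nat -> d * INR k ^ 2 <= (d - c) * INR n ->
  c * INR n ^ k <= d * (INR n - INR k) ^ k.
Proof.
move=> d0 n0 /leP/le_INR kn le.
have x01 : 0 <= INR k / INR n <= 1.
  split; first by apply: Rmult_le_pos; [exact: pos_INR | left; apply: Rinv_0_lt_compat].
  apply: (Rmult_le_reg_r (INR n)) => //.
  by rewrite /Rdiv Rmult_assoc Rinv_l; lra.
have -> : (INR n - INR k) ^ k = (1 - INR k / INR n) ^ k * INR n ^ k.
  by rewrite -Rpow_mult_distr; congr (_ ^ _); field; lra.
rewrite -Rmult_assoc; apply: Rmult_le_compat_r; first by apply: pow_le; lra.
(* Bernoulli's inequality reduces the claim to one that is linear in [k / n]. *)
have := Rmult_le_compat_l _ _ _ d0 (Bernoulli_sub k x01).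
suff : c <= d * (1 - INR k * (INR k / INR n)) by lra.
apply: (Rmult_le_reg_r (INR n)) => //.
have -> : d * (1 - INR k * (INR k / INR n)) * INR n = d * INR n - d * INR k ^ 2.
  by field; lra.
lra.
Qed.

(* [d * (F - 1) < ln F] holds near [F = 1] because [d < 1]. *)
Lemma growth_rate_gt1 (d : R) : 0 < d < 1 ->
  exists F z : R, [/\ 1 < F < 2, 1 < z & z * exp (d * (F - 1)) = F].
Proof.
move=> d01; set h := (1 - d) / 2.
have h0 : 0 < h < 1 by rewrite /h; lra.
exists (1 + h), ((1 + h) * exp (- (d * h))).
split; [lra | | ]; last first.
  rewrite (_ : 1 + h - 1 = h); last ring.
  by rewrite Rmult_assoc -exp_plus Rplus_opp_l exp_0; lra.
have ge : 1 - d * h <= exp (- (d * h)).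
  by have := exp_ineq1_le (- (d * h)); lra.
have : 1 < (1 + h) * (1 - d * h).
  have -> : (1 + h) * (1 - d * h) = 1 + h * h * (2 - d) by rewrite /h; field.
  by have := Rmult_lt_0_compat (h * h) (2 - d); nra.
by move=> lt; apply: Rlt_le_trans lt _; apply: Rmult_le_compat_l; lra.
Qed.

Lemma Rpow_lower_bound (z : R) (n m : nat) : 1 < z -> 0 < INR n ->
  ~ INR m <= 3 / ln z * ln (INR n) -> INR n ^ 3 <= z ^ m.
Proof.
move=> z1 n0 /Rnot_le_lt lt.
have lz : 0 < ln z by rewrite -ln_1; apply: ln_increasing; lra.
rewrite -!Rpower_pow //; last lra.
left; apply: exp_increasing.
have := Rmult_lt_compat_r _ _ _ lz lt.
suff -> : 3 / ln z * ln (INR n) * ln z = INR 3 * ln (INR n) by [].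
by rewrite /=; field; lra.
Qed.

Lemma Pr_disconnected_lt (k n : nat) (A B : assignment n) (p eps d F z : R) :
  0 < p < 1 -> 0 <= eps <= 1 / 2 -> 1 < F < 2 -> 1 < z ->
  z * exp (d * (F - 1)) = F -> 2 <= INR n ->
  p * INR n * (eps ^ 2 + (1 - eps) ^ 2) *
    (INR 'C(#|same_vars A B|, k - 2) * (1 - eps) ^ (k - 2)) <= d ->
  Pr k p eps (fun Phi => [&& models A Phi, models B Phi &
                 ~~ l_connected (3 / ln z * ln (INR n)) Phi A B])
  < / INR n * Pr k p eps (fun Phi => models A Phi && models B Phi).
Proof.
move=> p01 eps01 F12 z1 zF n2 deg.
have -> : Pr k p eps (fun Phi => models A Phi && models B Phi) =
          unsat_factor k A B p eps.
  rewrite -[RHS]Rmult_1_r.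
  rewrite -(Ex_const (clause_prob p eps) (joint_clauses k A B) 1).
  rewrite -(Pr_joint k A B p eps xpredT); apply: eq_bigl => Phi.
  by rewrite andbT.
rewrite (Pr_joint k A B p eps
  (fun Phi => ~~ l_connected (3 / ln z * ln (INR n)) Phi A B)) Rmult_comm.
have prob (C : clause n) : 0 <= clause_prob p eps C <= p.
  by split; [apply: clause_prob_ge0 | apply: clause_prob_le]; lra.
(* The conditioning event has positive probability because each clause has probability at most
   [p < 1], so it can be divided out. *)
apply: Rmult_lt_compat_r.
  by apply: Rprod_gt0 => C _; have := prob C; lra.
set J := joint_clauses k A B; set l := 3 / ln z * ln (INR n).
have p01' C : C \in J -> 0 <= clause_prob p eps C <= 1.
  by have := prob C; lra.
have n3 : 0 < INR n ^ 3 by apply: pow_lt; lra.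
(* The Markov weight: the threshold [l] satisfies [l * ln z = 3 * ln n], so a component larger than
   [l] makes this at least 1. *)
pose f v (Phi : {set clause n}) :=
  / INR n ^ 3 * z ^ #|cl (@diff_support n A B) Phi [set v]|.
have f0 v Phi : 0 <= f v Phi.
  apply: Rmult_le_pos; first by left; apply: Rinv_0_lt_compat.
  by apply: pow_le; lra.
apply: (Rle_lt_trans _ (\big[Rplus/0]_(v in diff_vars A B)
    Ex (clause_prob p eps) J (f v))).
  rewrite -Ex_sum; apply: ler_Ex => // Phi sub; case: ifP => [ncon|_]; last first.
    exact: Rsum_ge0.
  have [v vD vbig] : exists2 v, v \in diff_vars A B &
      ~ INR #|cl (@diff_support n A B) Phi [set v]| <= l.
    case: (boolP [exists v in diff_vars A B,
        ~~ (Rle_dec (INR #|cl (@diff_support n A B) Phi [set v]|) l : bool)]).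
      by case/exists_inP => v vD nle; exists v => //; case: Rle_dec nle.
    move/exists_inPn => small; case/negP: ncon; apply: l_connected_small.
    - by apply/forall_inP => C /(subsetP sub); rewrite inE => /and3P[].
    - by apply/forall_inP => C /(subsetP sub); rewrite inE => /and3P[].
    by move=> v /small; case: Rle_dec.
  rewrite (bigD1 v vD) /=.
  rewrite -[X in X <= _]Rplus_0_r; apply: Rplus_le_compat; last exact: Rsum_ge0.
  rewrite /f -(Rinv_l (INR n ^ 3)); last lra.
  apply: Rmult_le_compat_l; first by left; apply: Rinv_0_lt_compat.
  by apply: Rpow_lower_bound => //; lra.
apply: (Rle_lt_trans _ (\big[Rplus/0]_(v in diff_vars A B) (/ INR n ^ 3 * F))).
  apply: ler_Rsum => v vD; rewrite Ex_scale.
  apply: Rmult_le_compat_l; first by left; apply: Rinv_0_lt_compat.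
  have brF w : branch (@diff_support n A B) (clause_prob p eps) z F J w <= F.
    case: (boolP (w \in diff_vars A B)) => wD.
      rewrite -[X in _ <= X]zF; apply: branch_le; try lra.
        by move=> C _; case: (prob C).
      by apply: Rle_trans deg; apply: degree_le => //; lra.
    (* A variable on which [A] and [B] agree meets no edge, so its factor is just [z], which is at
       most [F] because [d] is nonnegative. *)
    rewrite /branch big_pred0 ?Rmult_1_r; last first.
      by move=> C; rewrite !inE in wD *; rewrite (negPf wD) andbF.
    rewrite -[X in _ <= X]zF -[X in X <= _]Rmult_1_r.
    apply: Rmult_le_compat_l; first lra.
    suff : 0 <= d * (F - 1) by have := exp_ineq1_le (d * (F - 1)); lra.
    apply: Rmult_le_pos; last lra.
    apply: Rle_trans deg; repeat apply: Rmult_le_pos; try exact: pos_INR; try lra.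
    - by nra.
    - by apply: pow_le; lra.
  have supp2 C : C \in J -> (#|diff_support A B C| <= 2)%nat.
    by rewrite inE => /and3P[_]; apply: diff_support_le2.
  have F1 : 1 <= F by lra.
  apply: (Rle_trans _ _ _ (Ex_cl_le (Rlt_le _ _ z1) F1 [set v] supp2 p01' brF)).
  by rewrite big_set1.
rewrite Rsum_const.
have card_le : INR #|diff_vars A B| <= INR n.
  by apply/le_INR/leP; rewrite -[X in (_ <= X)%nat]card_ord; apply: max_card.
have c0 : 0 < / INR n ^ 3 * F.
  by apply: Rmult_lt_0_compat; [apply: Rinv_0_lt_compat | lra].
apply: (Rle_lt_trans _ (INR n * (/ INR n ^ 3 * F))).
  by apply: Rmult_le_compat_r; [left|].
(* The exponent 3 leaves a spare factor [F / n], below 1 since [F < 2 <= n]. *)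
have -> : INR n * (/ INR n ^ 3 * F) = / INR n * (F / INR n) by field; lra.
rewrite -[X in _ < X]Rmult_1_r; apply: Rmult_lt_compat_l.
  by apply: Rinv_0_lt_compat; lra.
apply: (Rmult_lt_reg_r (INR n)); first lra.
by rewrite /Rdiv Rmult_assoc Rinv_l; lra.
Qed.

Local Close Scope R_scope.

Theorem theorem2 (k : nat) (eps c : R) :
  (3 <= k)%N ->
  (0 <= eps <= 1 / 2)%R ->
  (0 < c < 1)%R ->
  exists lam : R, (0 < lam)%R /\
  forall (A B : forall n : nat, assignment n),
    (forall n : nat, (2 * (overlap (A n) (B n) * (1 - eps)) ^ (k - 2) <= 1)%R) ->
    exists N : nat, forall n : nat, (N <= n)%N ->
      (Pr k (p_param k eps c n) eps
          (fun Phi => [&& models (A n) Phi, models (B n) Phi &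
                          ~~ l_connected (lam * ln (INR n)) Phi (A n) (B n)])
       < / INR n * Pr k (p_param k eps c n) eps
          (fun Phi => models (A n) Phi && models (B n) Phi))%R.
Proof.
(* Being below 1, [d] yields a subcritical exploration; being above [c], it leaves room for the
   ratio of [n ^ k] to [(n - k) ^ k]. *)
move=> k3 eps01 c01; set d := ((1 + c) / 2)%R.
have d01 : (0 < d < 1)%R by rewrite /d; lra.
have [F [z [F12 z1 zF]]] := growth_rate_gt1 d01.
have lz : (0 < ln z)%R by rewrite -ln_1; apply: ln_increasing; lra.
exists (3 / ln z)%R; split; first by apply: Rdiv_lt_0_compat; lra.
move=> A B ov; have dc : (0 < d - c)%R by rewrite /d; lra.
(* The terms in [k] and [k!] serve the bounds on the clause probability; the last one lets [d]
   absorb the error from Bernoulli's inequality. *)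
have [N ltN] := INR_unbounded
  (2 * INR k + 2 + 8 * INR k`! + d * INR k ^ 2 / (d - c))%R.
exists N => n /leP/le_INR leNn.
have kpos := pos_INR k; have fpos := pos_INR k`!.
have sq : (0 <= d * INR k ^ 2 / (d - c))%R.
  apply: Rmult_le_pos; last by left; apply: Rinv_0_lt_compat.
  by apply: Rmult_le_pos; [lra | apply: pow_le].
have nk : (2 * INR k + 2 < INR n)%R by lra.
have nf : (8 * INR k`! < INR n)%R by lra.
have kn : k <= n by apply/leP/INR_le; lra.
apply: (Pr_disconnected_lt _ eps01 F12 z1 zF).
- by split; [apply: p_param_gt0 | apply: p_param_lt1].
- lra.
apply: degree_estimate => //; try lra; last exact: ov.
apply: ler_Rpow_scaled => //; try lra.
have -> : (d * INR k ^ 2 = (d - c) * (d * INR k ^ 2 / (d - c)))%R by field; lra.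
by apply: Rmult_le_compat_l; lra.
Qed.
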